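(* Let $n\ge 1$. There are $n$ coins, each of which has one of three possible weights $w_1<w_2<w_3$, and a balance scale on which each pan holds only one coin. Then one cannot guarantee sorting the coins in fewer than $\lceil 3n/2\rceil-2$ weighings; that is, every strategy that always sorts the coins uses at least $\lceil 3n/2\rceil-2$ weighings in the worst case.
   Context: The coins are labelled and look identical; the assignment of the weights $w_1<w_2<w_3$ to the coins is unknown and arbitrary (in particular, not all three weights need occur), and the numerical values of the weights are unknown. A weighing on a balance scale with tiny pans (each pan fits only one coin) compares one coin against one other coin and reports whether the two weigh the same, the left one is lighter, or the left one is heavier. A strategy is adaptive: each weighing may depend on the outcomes of the previous ones. To sort the coins means to determine the partition of the coins into groups such that coins in the same group weigh the same, coins in different groups have different weights, and for every two groups it is known which one contains the lighter coins. A strategy guarantees sorting in $m$ weighings if, for all weights $w_1<w_2<w_3$ and every assignment of them to the coins, it uses at most $m$ weighings and its outcomes determine the sorting. *)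

(* Defs.v *)
From mathcomp Require Import all_boot all_order all_algebra.

Set Implicit Arguments.
Unset Strict Implicit.
Unset Printing Implicit Defensive.

Import Order.TTheory GRing.Theory Num.Theory.
Local Open Scope ring_scope.

Inductive outcome : Type := Balanced | LeftLighter | LeftHeavier.

(* Termination is built in: each branch consists of finitely many weighings.
   [Weigh i j neq next] puts coin [i] on the left pan and coin [j] on the
   right one. *)
Inductive strategy (n : nat) : Type :=
  | Stop
  | Weigh (i j : 'I_n) of i != j & (outcome -> strategy n).

Section Coins.

Variables (R : realFieldType) (n : nat).
Implicit Types (f : 'I_n -> R) (S : strategy n).

(* [f i] is the weight of coin [i]; some of the three weights may be unused. *)
Definition three_weights f : Prop :=
  exists w1 w2 w3 : R,
    [/\ w1 < w2, w2 < w3 & forall i : 'I_n, f i \in [:: w1; w2; w3]].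

Definition weighing f (i j : 'I_n) : outcome :=
  if f i == f j then Balanced
  else if f i < f j then LeftLighter else LeftHeavier.

Fixpoint outcomes S f : seq outcome :=
  match S with
  | Stop => [::]
  | Weigh i j _ next =>
      let o := weighing f i j in o :: outcomes (next o) f
  end.

Definition num_weighings S f : nat := size (outcomes S f).

Definition groups f : {set {set 'I_n}} := preim_partition f [set: 'I_n].

Definition lighter_group f (A B : {set 'I_n}) : bool :=
  [forall i in A, forall j in B, f i < f j].

(* The numerical values of the weights are not part of a sorting. *)
Definition sorting f : {set {set 'I_n}} * {set {set 'I_n} * {set 'I_n}} :=
  (groups f,
   [set AB in setX (groups f) (groups f) | lighter_group f AB.1 AB.2]).

(* The weights being unknown, [f] and [g] need not use the same three. *)
Definition always_sorts S : Prop :=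
  forall f g, three_weights f -> three_weights g ->
    outcomes S f = outcomes S g -> sorting f = sorting g.

Definition guarantees_sorting_in S (m : nat) : Prop :=
  always_sorts S /\ forall f, three_weights f -> (num_weighings S f <= m)%N.

End Coins.

Arguments always_sorts R {n} S.
Arguments guarantees_sorting_in R {n} S m.

(* Main.v *)
(** An adversary colours each coin light or heavy when it is first weighed, so
    that every coin takes part in a weighing against the opposite colour; there
    are at least [n / 2] such weighings.  A weighing of two coins of the same
    colour balances.  If these monochrome weighings left one of the two colour
    classes disconnected, giving the middle weight to one component would change
    the sorting but no outcome; so there are at least [n - 2] of them. *)
Require Import Defs.
From mathcomp Require Import all_boot all_order all_algebra.
From mathcomp Require Import zify lra.

Set Implicit Arguments.
Unset Strict Implicit.
Unset Printing Implicit Defensive.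

Import Order.TTheory GRing.Theory Num.Theory.
Local Open Scope ring_scope.

(* A graph has at least [#|T| - size E] components, [c] naming them. *)
Lemma exists_edge_labelling (T : finType) (E : seq (T * T)) :
  exists c : T -> T,
    {in E, forall e, c e.1 = c e.2} /\ (#|T| <= #|c @: T| + size E)%N.
Proof.
elim: E => [|[i j] E [c [cE leTc]]].
  by exists id; split=> //; rewrite card_imset // addn0.
exists (fun x => if c x == c i then c j else c x); split.
  move=> e; rewrite inE => /predU1P[-> | /cE-> //].
  by rewrite /= eqxx; case: ifP.
set c' := fun x => _.
(* Only the label [c i] can vanish from the image, so a new edge costs at most one label. *)
have sub : c @: T \subset c i |: c' @: T.
  apply/subsetP=> _ /imsetP[x _ ->]; rewrite !inE.
  have [//|/negPf cxi] := eqVneq (c x) (c i).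
  by apply/imsetP; exists x; rewrite // /c' cxi.
apply: leq_trans leTc _; rewrite addnS -addSn leq_add2r.
apply: leq_trans (subset_leq_card sub) _.
by rewrite cardsU1 -add1n leq_add2r leq_b1.
Qed.

Section Weighings.

Variables (R : realFieldType) (n : nat).
Implicit Types (f g : 'I_n -> R) (S : strategy n) (b : 'I_n -> bool).

Fixpoint weighed_pairs S f : seq ('I_n * 'I_n) :=
  match S with
  | Stop => [::]
  | Weigh i j _ next => (i, j) :: weighed_pairs (next (weighing f i j)) f
  end.

Lemma size_weighed_pairs S f : size (weighed_pairs S f) = num_weighings S f.
Proof.
by rewrite /num_weighings; elim: S => //= i j _ next IH; rewrite IH.
Qed.

(** Each weighing is chosen from earlier outcomes alone, so agreement on the pairs weighed under [f]
    keeps [g] on the same branch. *)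
Lemma eq_outcomes S f g :
  {in weighed_pairs S f, forall e, weighing g e.1 e.2 = weighing f e.1 e.2} ->
  outcomes S f = outcomes S g.
Proof.
elim: S => //= i j _ next IH fg.
have /= -> := fg (i, j) (mem_head _ _); congr (_ :: _).
by apply: IH => e e_in; apply: fg; rewrite inE e_in orbT.
Qed.

Lemma sorting_eq_weight f g :
  sorting f = sorting g -> forall i j, f i = f j -> g i = g j.
Proof.
case=> fg _ i j fij.
have P h : equivalence_partition (fun x y => h x == h y) [set: 'I_n] = groups h
  by [].
have eqi h : {in [set: 'I_n] & &, equivalence_rel (fun x y : 'I_n => h x == h y :> R)}.
  by move=> x y z _ _ _; split=> // /eqP->.
have := pblock_equivalence_partition (eqi f) (in_setT i) (in_setT j).
rewrite P fg -P pblock_equivalence_partition ?inE // fij eqxx.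
by move/eqP.
Qed.

Lemma always_sorts_eq_weight S f g :
  always_sorts R S -> three_weights f -> three_weights g ->
  {in weighed_pairs S f, forall e, weighing g e.1 e.2 = weighing f e.1 e.2} ->
  forall i j, f i = f j <-> g i = g j.
Proof.
move=> sortS f3 g3 /eq_outcomes/(sortS _ _ f3 g3) fg i j.
by split; apply: sorting_eq_weight.
Qed.

(** The gap between [0] and [2] leaves room for a middle weight [1]. *)
Definition two_weights b (i : 'I_n) : R := if b i then 2 else 0.

(* The coins of [D] already have their colours. *)
Lemma exists_adversary_colouring S (D : {set 'I_n}) b :
  exists b', {in D, b' =1 b} /\
    {in weighed_pairs S (two_weights b'), forall e i,
       i \in [:: e.1; e.2] -> i \notin D ->
       exists2 e', e' \in weighed_pairs S (two_weights b') &
         (i \in [:: e'.1; e'.2]) && (b' e'.1 != b' e'.2)}.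
Proof.
elim: S D b => [|i j neq next IH] D b; first by exists b.
(* A coin outside [D] is still free and can take the colour opposite to its partner's; with both
   coins in [D], nothing is recoloured. *)
have [b1 b1D b1ij] : exists2 b1, {in D, b1 =1 b} &
    (i \notin D) || (j \notin D) -> b1 i != b1 j.
  have [iD|iD] := boolP (i \in D); last first.
    exists (fun x => if x == i then ~~ b j else b x).
      by move=> x xD /=; case: eqP => // xi; rewrite -xi xD in iD.
    by rewrite eqxx [j == i]eq_sym (negPf neq); case: (b j).
  have [jD|jD] := boolP (j \in D); first by exists b.
  exists (fun x => if x == j then ~~ b i else b x).
    by move=> x xD /=; case: eqP => // xj; rewrite -xj xD in jD.
  by rewrite eqxx (negPf neq); case: (b i).
(* Fixing [i] and [j] from here on makes the final colouring [b'] produce the very outcome that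
   selected this branch. *)
have [b' [b'D b'E]] := IH (weighing (two_weights b1) i j) (i |: (j |: D)) b1.
have b'ij : weighing (two_weights b') i j = weighing (two_weights b1) i j.
  by rewrite /weighing /two_weights !b'D // !inE eqxx ?orbT.
exists b'; split=> [x xD|].
  by rewrite b'D ?b1D // !inE xD !orbT.
rewrite /= b'ij => e e_in k ke kD.
have [kij|kij] := boolP (k \in [:: i; j]).
  exists (i, j); rewrite ?mem_head //= kij /= !b'D ?inE ?eqxx ?orbT //.
  apply: b1ij; move: kij; rewrite !inE => /orP[]/eqP<-; rewrite kD ?orbT //.
move: e_in; rewrite inE => /predU1P[ee|e_in]; first by rewrite ee (negPf kij) in ke.
have [|e' e'_in e'P] := b'E e e_in k ke.
  by move: kij; rewrite !inE !negb_or kD => /andP[-> ->].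
by exists e' => //; rewrite inE e'_in orbT.
Qed.

Lemma three_weights_012 f :
  (forall i, f i \in [:: 0; 1; 2]) -> three_weights f.
Proof. by move=> f012; exists 0, 1, 2; split=> //; lra. Qed.

Lemma two_weights_three b : three_weights (two_weights b).
Proof.
apply: three_weights_012 => i.
by rewrite /two_weights !inE; case: ifP => _; rewrite eqxx ?orbT.
Qed.

Lemma eq_two_weights b i j :
  (two_weights b i = two_weights b j) <-> (b i = b j).
Proof.
rewrite /two_weights; split=> [|->//].
by case: (b i) (b j) => [] [] // h; exfalso; lra.
Qed.

(** Flipping the colour of a coin that is never weighed changes no outcome, yet changes whether it
    weighs the same as [k]. *)
Lemma always_sorts_weighs_each S b i k : k != i -> always_sorts R S ->
  exists2 e, e \in weighed_pairs S (two_weights b) & i \in [:: e.1; e.2].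
Proof.
move=> ki sortS; set E := weighed_pairs _ _.
have [/hasP[e]|/hasPn nE] := boolP (has (fun e => i \in [:: e.1; e.2]) E).
  by exists e.
pose b' x := if x == i then ~~ b i else b x.
have := always_sorts_eq_weight sortS (two_weights_three b)
          (two_weights_three b') _ i k.
rewrite !eq_two_weights /b' eqxx (negPf ki) => H.
have /H : {in E, forall e,
    weighing (two_weights b') e.1 e.2 = weighing (two_weights b) e.1 e.2}.
  move=> e /nE; rewrite !inE negb_or /weighing /two_weights /b'.
  by rewrite ![i == _]eq_sym => /andP[/negPf-> /negPf->].
by case: (b i) (b k) => [] [] [h1 h2]; have := h1; have := h2;
   intuition discriminate.
Qed.

Lemma always_sorts_monochrome_connected S b (c : 'I_n -> 'I_n) x y :
    always_sorts R S ->
    {in weighed_pairs S (two_weights b), forall e,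
       b e.1 = b e.2 -> c e.1 = c e.2} ->
  b x = b y -> c x = c y.
Proof.
move=> sortS cE bxy; apply/eqP/negPn/negP => cxy.
pose g z : R := if (b z == b x) && (c z == c x) then 1 else two_weights b z.
have g3 : three_weights g.
  apply: three_weights_012 => z; rewrite /g /two_weights !inE.
  by case: ifP => _; [|case: ifP => _]; rewrite eqxx ?orbT.
have gE : {in weighed_pairs S (two_weights b), forall e,
    weighing g e.1 e.2 = weighing (two_weights b) e.1 e.2}.
  move=> e /cE; rewrite /weighing /g /two_weights.
  (* In a monochrome weighing [c] agrees on the two coins, so both move to weight [1] or neither
     does. Across colours at most one coin moves, and [1] lies strictly between [0] and [2]. *)
  have [be /(_ be) ce|be _] := eqVneq (b e.1) (b e.2).
    by rewrite be ce !eqxx.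
  case: (b e.1) (b e.2) be => [] [] // _; case: (b x) => /=; case: (_ == c x) => //;
  by do 2?[case: ltgtP => ? //]; exfalso; lra.
have [+ _] := always_sorts_eq_weight sortS (two_weights_three b) g3 gE x y.
rewrite eq_two_weights => /(_ bxy); rewrite /g bxy !eqxx /=.
rewrite [c y == _]eq_sym (negPf cxy) /two_weights.
by case: ifP => _ h; exfalso; lra.
Qed.

(** Each counted weighing has only two ends, and every coin must be one of these ends. *)
Lemma cross_weighings_lower_bound (E : seq ('I_n * 'I_n)) (P : pred ('I_n * 'I_n)) :
  (forall i, exists2 e, e \in E & (i \in [:: e.1; e.2]) && P e) ->
  (n <= (count P E).*2)%N.
Proof.
move=> cov; pose s := [seq e.1 | e <- filter P E] ++ [seq e.2 | e <- filter P E].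
have -> : (count P E).*2 = size s.
  by rewrite size_cat !size_map size_filter addnn.
rewrite -[leqLHS]card_ord; apply: leq_trans (card_size s).
apply: subset_leq_card; apply/subsetP=> i _.
have [e eE /andP[ie Pe]] := cov i.
have ePE : e \in filter P E by rewrite mem_filter Pe.
rewrite mem_cat; move: ie; rewrite !inE => /orP[]/eqP->.
  by rewrite (map_f fst).
by rewrite (map_f snd) ?orbT.
Qed.

(** Each monochrome weighing merges at most two components, and in the end at most one component per
    colour may remain. *)
Lemma monochrome_weighings_lower_bound S b : (0 < n)%N -> always_sorts R S ->
  (n <= (count (fun e => b e.1 == b e.2) (weighed_pairs S (two_weights b))).+2)%N.
Proof.
move=> n_gt0 sortS; set P := fun e => _; set E := weighed_pairs _ _.
have [c [cE]] := exists_edge_labelling (filter P E).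
rewrite card_ord size_filter => /leq_trans; apply; rewrite -add2n leq_add2r.
have cb x y : b x = b y -> c x = c y.
  apply: (always_sorts_monochrome_connected sortS) => e eE be.
  by apply: cE; rewrite mem_filter eE andbT; apply/eqP.
(* [F] recovers the label from the colour; the default [Ordinal n_gt0] serves a colour that no coin
   has. *)
pose F t := if [pick x | b x == t] is Some x then c x else Ordinal n_gt0.
rewrite -card_bool; apply: leq_trans (leq_imset_card F {: bool}).
apply: subset_leq_card; apply/subsetP=> _ /imsetP[x _ ->].
apply/imsetP; exists (b x) => //; rewrite /F.
by case: pickP => [y /eqP/cb-> // | /(_ x)]; rewrite eqxx.
Qed.

End Weighings.

Theorem theorem4p2 (R : realFieldType) (n : nat) (hn : (1 <= n)%N) :
  (forall m : nat, (m < uphalf (3 * n) - 2)%N ->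
     ~ exists S : strategy n, guarantees_sorting_in R S m) /\
  (forall S : strategy n, always_sorts R S ->
     exists f : 'I_n -> R,
       three_weights f /\ (uphalf (3 * n) - 2 <= num_weighings S f)%N).
Proof.
have bound (S : strategy n) : always_sorts R S ->
    exists f : 'I_n -> R,
      three_weights f /\ (uphalf (3 * n) - 2 <= num_weighings S f)%N.
  move=> sortS.
  have [b [_ bE]] := exists_adversary_colouring R S set0 xpredT.
  exists (two_weights R b); split; first exact: two_weights_three.
  (* A single coin is never weighed, so the count of cross weighings needs a second coin; for
     [n = 1] the bound is [0]. *)
  have [n_le1|n_gt1] := leqP n 1.
    by have -> : (uphalf (3 * n) - 2 = 0)%N by lia.
  have mono := monochrome_weighings_lower_bound b hn sortS.
  have cross := @cross_weighings_lower_bound n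
    (weighed_pairs S (two_weights R b)) (fun e => b e.1 != b e.2).
  rewrite -size_weighed_pairs -(count_predC (fun e => b e.1 == b e.2)).
  suff /cross : forall i, exists2 e, e \in weighed_pairs S (two_weights R b) &
      (i \in [:: e.1; e.2]) && (b e.1 != b e.2).
    have -> : count (predC (fun e => b e.1 == b e.2)) =1
              count (fun e => b e.1 != b e.2) by [].
    lia.
  move=> i; have [k ki] : exists k : 'I_n, k != i.
    have := cardC1 i; rewrite card_ord => cardi.
    have /card_gt0P[k ki] : (0 < #|predC1 i|)%N by rewrite cardi; lia.
    by exists k.
  have [e eE ie] := always_sorts_weighs_each b ki sortS.
  by apply: bE eE _ ie _; rewrite inE.
split=> // m m_lt [S [sortS leS]].
have [f [/leS f3 ge_f]] := bound S sortS.
by have := leq_trans ge_f f3; rewrite leqNgt m_lt.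
Qed.
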